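(* Let $(\mathbf A_n)$ be a sequence of finite $\lambda$-structures. Then $(\mathbf A_n)$ is $\mathrm{FO}$-convergent if and only if it is both $\mathrm{FO}^{\mathrm{local}}$-convergent and $\mathrm{FO}_0$-convergent. More precisely, for every $p$, $(\mathbf A_n)$ is $\mathrm{FO}_p$-convergent if and only if it is both $\mathrm{FO}_p^{\mathrm{local}}$-convergent and $\mathrm{FO}_0$-convergent.
   Context: $\lambda$ is a countable relational signature. $\mathrm{FO}$ is the set of first-order $\lambda$-formulas with free variables among $x_1,x_2,\dots$; $\mathrm{FO}_p$ those with free variables among $x_1,\dots,x_p$ ($\mathrm{FO}_0$ = sentences). For $\phi\in\mathrm{FO}_p$ and a finite $\lambda$-structure $\mathbf A$ with domain $A$, $\langle\phi,\mathbf A\rangle=|\{(v_1,\dots,v_p)\in A^p:\mathbf A\models\phi(v_1,\dots,v_p)\}|/|A|^p$ (for a sentence: $1$ if true, $0$ otherwise); for a set $X$ of formulas, $(\mathbf A_n)$ is $X$-convergent if $\langle\phi,\mathbf A_n\rangle$ converges for every $\phi\in X$. Distances in a $\lambda$-structure are measured in its Gaifman graph (two distinct elements adjacent iff they occur together in some tuple of some relation). A formula $\phi\in\mathrm{FO}_p$ is $r$-local if for every $\lambda$-structure $\mathbf A$ and $v_1,\dots,v_p\in A$, $\mathbf A\models\phi(v_1,\dots,v_p)$ iff the substructure induced by the elements at distance at most $r$ from some $v_i$ satisfies $\phi(v_1,\dots,v_p)$; $\phi$ is local if it is $r$-local for some $r$. $\mathrm{FO}^{\mathrm{local}}$ is the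 set of local formulas and $\mathrm{FO}^{\mathrm{local}}_p=\mathrm{FO}^{\mathrm{local}}\cap\mathrm{FO}_p$. *)

(* Defs.v *)
From mathcomp Require Import all_boot.
From Stdlib Require Import Reals ClassicalDescription.

Set Implicit Arguments.
Unset Strict Implicit.
Unset Printing Implicit Defensive.

Record signature := Signature {
  sym : countType;
  arity : sym -> nat
}.

(* First-order formulas with equality.  Variable [i : nat] stands for x_(i+1). *)
Inductive formula (L : signature) : Type :=
  | FEq : nat -> nat -> formula L
  | FRel : forall r : sym L, (arity r).-tuple nat -> formula L
  | FNot : formula L -> formula L
  | FAnd : formula L -> formula L -> formula L
  | FEx : nat -> formula L -> formula L.

Arguments FEq {L}.

Fixpoint free_in (L : signature) (P : pred nat) (phi : formula L) : bool :=
  match phi with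
  | FEq i j => P i && P j
  | FRel _ t => all P t
  | FNot psi => free_in P psi
  | FAnd psi1 psi2 => free_in P psi1 && free_in P psi2
  | FEx i psi => free_in (predU1 i P) psi
  end.

Definition FO_p (L : signature) (p : nat) (phi : formula L) : bool :=
  free_in (fun k => k < p) phi.

Record structure (L : signature) := Structure {
  dom : Type;
  rel : forall r : sym L, (arity r).-tuple dom -> Prop
}.

(* Partial assignments: unassigned variables make atoms false (irrelevant
   for formulas whose free variables are all assigned). *)
Definition upd (T : Type) (e : nat -> option T) (i : nat) (a : T) :=
  fun k => if k == i then Some a else e k.

(* Satisfaction in the substructure of [S] induced on the subset [D]
   (quantifiers range over [D], relations are restricted to [D]). *)
Fixpoint holds_in (L : signature) (S : structure L) (D : dom S -> Prop)
    (e : nat -> option (dom S)) (phi : formula L) : Prop :=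
  match phi with
  | FEq i j => match e i, e j with Some a, Some b => a = b | _, _ => False end
  | FRel r t => exists u : (arity r).-tuple (dom S),
      (forall k : 'I_(arity r), e (tnth t k) = Some (tnth u k)) /\ rel u
  | FNot psi => ~ holds_in D e psi
  | FAnd psi1 psi2 => holds_in D e psi1 /\ holds_in D e psi2
  | FEx i psi => exists a, D a /\ holds_in D (upd e i a) psi
  end.

Definition holds (L : signature) (S : structure L) e (phi : formula L) :=
  holds_in (fun _ : dom S => True) e phi.

Definition env_of (T : Type) (p : nat) (v : 'I_p -> T) : nat -> option T :=
  fun k => match (insub k : option 'I_p) with Some j => Some (v j) | None => None end.

Definition gaif_adj (L : signature) (S : structure L) (x y : dom S) : Prop :=
  x <> y /\ exists (r : sym L) (t : (arity r).-tuple (dom S)),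
    rel t /\ exists i j : 'I_(arity r), tnth t i = x /\ tnth t j = y.

Fixpoint gaif_within (L : signature) (S : structure L) (d : nat) (x y : dom S) : Prop :=
  match d with
  | 0 => x = y
  | d'.+1 => gaif_within d' x y \/ exists z, gaif_within d' x z /\ gaif_adj z y
  end.

Definition r_local (L : signature) (p r : nat) (phi : formula L) : Prop :=
  forall (S : structure L) (v : 'I_p -> dom S),
    holds (env_of v) phi <->
    holds_in (fun a => exists i : 'I_p, gaif_within r (v i) a) (env_of v) phi.

Definition FO_local_p (L : signature) (p : nat) (phi : formula L) : Prop :=
  FO_p p phi /\ exists r, r_local p r phi.

Record finStructure (L : signature) := FinStructure {
  fdom : finType;
  frel : forall r : sym L, pred ((arity r).-tuple fdom);
  fdom_nonempty : 0 < #|fdom|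
}.

Definition struct_of (L : signature) (A : finStructure L) : structure L :=
  @Structure L (fdom A) (fun r t => frel t).

Definition pb (P : Prop) : bool :=
  if excluded_middle_informative P then true else false.

Definition stone (L : signature) (p : nat) (phi : formula L) (A : finStructure L) : R :=
  (INR #|[set v : {ffun 'I_p -> fdom A} |
            pb (holds (S := struct_of A) (env_of v) phi)]|
   / INR (#|fdom A| ^ p))%R.

Definition convergent (u : nat -> R) : Prop := exists l, Un_cv u l.

Definition FOp_convergent (L : signature) (p : nat) (A : nat -> finStructure L) :=
  forall phi : formula L, FO_p p phi -> convergent (fun n => stone p phi (A n)).

Definition FO_convergent (L : signature) (A : nat -> finStructure L) :=
  forall p, FOp_convergent p A.

Definition FOlocal_p_convergent (L : signature) (p : nat) (A : nat -> finStructure L) :=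
  forall phi : formula L, FO_local_p p phi -> convergent (fun n => stone p phi (A n)).

Definition FOlocal_convergent (L : signature) (A : nat -> finStructure L) :=
  forall p, FOlocal_p_convergent p A.

(* Main.v *)
(** Along a sequence whose sentences are all eventually constant, every formula
    eventually agrees with a local one, so its Stone pairing converges.  This is
    Gaifman's locality theorem by induction on formulas.  In the case of
    [exists y, psi x y] with [psi] of radius [r], a witness within distance
    [s = 2r+1] of [x] is sought locally.  For a witness farther away, the balls
    around [x] and [y] are disjoint and not adjacent, so by Feferman-Vaught
    [psi] is a finite disjunction of [alpha_j(x) /\ beta_j(y)], and it
    remains to express "some [y] far from [x] satisfies [beta_j]".  Consider
    sets of points satisfying [beta_j] at pairwise distance more than [2s].  If
    there are more points in such a set than variables in [x], one of them is
    far from [x].  Otherwise the maximal size [k] of such a set is eventually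
    constant; a far point exists iff either no such set of size [k] lies in the
    [s]-ball of [x], or there is a far point in the [3s]-ball of [x]. *)

Require Import Defs.
From Stdlib Require Import ClassicalDescription FunctionalExtensionality Lra.
From mathcomp Require Import all_boot.
From Stdlib Require Import Reals.
From mathcomp Require Import zify.

Set Implicit Arguments.
Unset Strict Implicit.
Unset Printing Implicit Defensive.

(** * Formulas under total assignments *)

Definition assign (T : Type) (e : nat -> T) (i : nat) (a : T) : nat -> T :=
  fun k => if k == i then a else e k.

Lemma assign_same (T : Type) (e : nat -> T) i a : assign e i a i = a.
Proof. by rewrite /assign eqxx. Qed.

Lemma assign_other (T : Type) (e : nat -> T) i a k : k != i -> assign e i a k = e k.
Proof. by rewrite /assign => /negbTE ->. Qed.

Section Formulas.

Variable L : signature.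
Implicit Types (S : structure L) (phi psi : formula L) (V U W : pred nat).

(** Total assignments replace the partial ones of [holds_in], so atoms carry no undefined case;
    [holds_in_sat] shows that nothing changes once the free variables are assigned. *)
Fixpoint sat S (D : dom S -> Prop) (e : nat -> dom S) phi : Prop :=
  match phi with
  | FEq i j => e i = e j
  | FRel r t => Defs.rel (map_tuple e t)
  | FNot psi => ~ sat D e psi
  | FAnd psi1 psi2 => sat D e psi1 /\ sat D e psi2
  | FEx i psi => exists a, D a /\ sat D (assign e i a) psi
  end.

Definition whole S : dom S -> Prop := fun _ => True.

(** Relation symbols are confined to a finite list as well: a formula uses only finitely many, and
    distances will be measured through these alone. *)
Fixpoint wff (Sg : seq (sym L)) V phi : bool :=
  match phi with
  | FEq i j => V i && V j
  | FRel r t => (r \in Sg) && all V t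
  | FNot psi => wff Sg V psi
  | FAnd psi1 psi2 => wff Sg V psi1 && wff Sg V psi2
  | FEx i psi => wff Sg (predU1 i V) psi
  end.

Fixpoint syms phi : seq (sym L) :=
  match phi with
  | FEq _ _ => [::]
  | FRel r _ => [:: r]
  | FNot psi => syms psi
  | FAnd psi1 psi2 => syms psi1 ++ syms psi2
  | FEx _ psi => syms psi
  end.

Lemma wff_free_in Sg V phi : wff Sg V phi -> free_in V phi.
Proof.
elim: phi V => //=; first by move=> r t V /andP[].
  by move=> f IHf g IHg V /andP[/IHf -> /IHg ->].
by move=> i f IH V /IH.
Qed.

Lemma free_in_wff Sg V phi :
  {subset syms phi <= Sg} -> free_in V phi -> wff Sg V phi.
Proof.
elim: phi V => //=.
- by move=> r t V sub ->; rewrite sub ?inE.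
- move=> f IHf g IHg V sub /andP[fV gV].
  by apply/andP; split; [apply: IHf | apply: IHg] => // r rf;
     apply: sub; rewrite mem_cat rf ?orbT.
- by move=> i f IH V sub; apply: IH.
Qed.

Lemma wff_mono Sg V U phi : (forall i, V i -> U i) -> wff Sg V phi -> wff Sg U phi.
Proof.
elim: phi V U => //=.
- by move=> i j V U VU /andP[/VU -> /VU ->].
- by move=> r t V U VU /andP[->] /= /allP h; apply/allP => x /h /VU.
- by move=> f IHf g IHg V U VU /andP[/(IHf _ _ VU) -> /(IHg _ _ VU) ->].
- by move=> i f IH V U VU; apply: IH => k /= /orP[-> // | /VU ->]; rewrite orbT.
Qed.

Lemma sat_ext Sg V phi S (D D' : dom S -> Prop) e e' :
  wff Sg V phi -> (forall i, V i -> e i = e' i) -> (forall a, D a <-> D' a) ->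
  sat D e phi <-> sat D' e' phi.
Proof.
elim: phi V e e' => /=.
- by move=> i j V e e' /andP[Vi Vj] ee' _; rewrite !ee'.
- move=> r t V e e' /andP[_ /allP Vt] ee' _.
  suff -> : map_tuple e t = map_tuple e' t by [].
  by apply: val_inj => /=; apply/eq_in_map => x /Vt /ee'.
- by move=> f IH V e e' wf ee' DD'; rewrite (IH _ _ _ wf ee' DD').
- move=> f IHf g IHg V e e' /andP[wf wg] ee' DD'.
  by rewrite (IHf _ _ _ wf ee' DD') (IHg _ _ _ wg ee' DD').
- move=> i f IH V e e' wf ee' DD'.
  have h a : sat D (assign e i a) f <-> sat D' (assign e' i a) f.
    apply: (IH _ _ _ wf) => // k /= /orP[/eqP -> | Vk]; first by rewrite !assign_same.
    by rewrite /assign; case: eqP => // _; apply: ee'.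
  by split=> -[a [Da /h sa]]; exists a; split=> //; apply/DD'.
Qed.

Lemma holds_in_sat P phi S (D : dom S -> Prop) (o : nat -> option (dom S)) e :
  free_in P phi -> (forall i, P i -> o i = Some (e i)) ->
  holds_in D o phi <-> sat D e phi.
Proof.
elim: phi P o e => /=.
- by move=> i j P o e /andP[Pi Pj] oe; rewrite !oe //; split=> [|->].
- move=> r t P o e /allP Pt oe; split=> [[u [ou]] | rt].
    suff -> : u = map_tuple e t by [].
    apply: eq_from_tnth => k; rewrite tnth_map.
    have := ou k; rewrite oe; first by case.
    by apply: Pt; apply: mem_tnth.
  exists (map_tuple e t); split=> // k; rewrite tnth_map oe //.
  by apply: Pt; apply: mem_tnth.
- by move=> f IH P o e Pf oe; rewrite (IH _ _ _ Pf oe).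
- move=> f IHf g IHg P o e /andP[Pf Pg] oe.
  by rewrite (IHf _ _ _ Pf oe) (IHg _ _ _ Pg oe).
- move=> i f IH P o e Pf oe.
  have h a : holds_in D (upd o i a) f <-> sat D (assign e i a) f.
    apply: (IH _ _ _ Pf) => // k /= /orP[/eqP -> | Vk].
      by rewrite assign_same /upd eqxx.
    by rewrite /assign /upd; case: eqP => // _; apply: oe.
  by split=> -[a [Da /h sa]]; exists a.
Qed.

(** A closed tautology, true even when [D] is empty; it pads conjunctions without adding free
    variables. *)
Definition FTrue : formula L := FNot (FEx 0 (FNot (FEq 0 0))).
Definition FOr phi psi : formula L := FNot (FAnd (FNot phi) (FNot psi)).

Lemma sat_FTrue S (D : dom S -> Prop) e : sat D e FTrue.
Proof. by case=> a []. Qed.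

Lemma sat_FOr S (D : dom S -> Prop) e phi psi :
  sat D e (FOr phi psi) <-> sat D e phi \/ sat D e psi.
Proof. by rewrite /=; split=> h; [apply: NNPP|]; tauto. Qed.

Fixpoint FExs (m n : nat) phi : formula L :=
  if n is n'.+1 then FEx m (FExs m.+1 n' phi) else phi.

Lemma wff_FExs Sg V m n phi :
  wff Sg (fun k => V k || (m <= k < m + n)) phi -> wff Sg V (FExs m n phi).
Proof.
elim: n m V => [|n IH] m V /=.
  by apply: wff_mono => k; case: (V k) => //=; lia.
move=> wf; apply: IH; apply: wff_mono wf => k /=.
by case: (V k); rewrite ?orbT //= orbF; case: eqP => //=; lia.
Qed.

Lemma sat_FExs S (D : dom S -> Prop) e m n phi :
  sat D e (FExs m n phi) <->
  exists f : nat -> dom S, (forall k, m <= k < m + n -> D (f k)) /\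
    sat D (fun k => if m <= k < m + n then f k else e k) phi.
Proof.
elim: n m e => [|n IH] m e /=.
  have E (f : nat -> dom S) : (fun k => if m <= k < m + 0 then f k else e k) = e.
    by apply: functional_extensionality => k; case: ifP => //; lia.
  split=> [h | [f [_]]]; last by rewrite E.
  by exists e; rewrite E; split=> // k; lia.
split.
  case=> a [Da /IH [f [Df sf]]]; exists (assign f m a); split.
    move=> k hk; rewrite /assign; case: eqP => [//|ne]; apply: Df; lia.
  congr sat: sf; apply: functional_extensionality => k; rewrite /assign.
  case: (eqVneq k m) => [->|ne]; first by rewrite leqnn ltnn /= addnS ltnS leq_addr.
  by have -> : (m <= k < m + n.+1) = (m < k < m.+1 + n) by lia.
case=> f [Df sf]; exists (f m); split; first by apply: Df; lia.
apply/IH; exists f; split; first by move=> k hk; apply: Df; lia.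
congr sat: sf; apply: functional_extensionality => k; rewrite /assign.
case: (eqVneq k m) => [->|ne]; first by rewrite leqnn ltnn /= addnS ltnS leq_addr.
by have -> : (m <= k < m + n.+1) = (m < k < m.+1 + n) by lia.
Qed.

End Formulas.

(** * Balls and locally definable queries *)

Section Locality.

Variables (L : signature) (Sg : seq (sym L)).
Implicit Types (S : structure L) (phi psi : formula L) (V U W X : pred nat).

(* Only the symbols in [Sg] count, since adjacency through infinitely many
   relations is not first-order definable. *)
Definition link S (x y : dom S) : Prop :=
  exists (r : sym L) (t : (arity r).-tuple (dom S)), r \in Sg /\ Defs.rel t /\
    exists i j : 'I_(arity r), tnth t i = x /\ tnth t j = y.

Fixpoint within S (d : nat) (x y : dom S) : Prop :=
  if d is d'.+1 then within d' x y \/ exists z, within d' x z /\ link z y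
  else x = y.

Definition near (r : nat) W S (e : nat -> dom S) (a : dom S) : Prop :=
  exists i, W i /\ within r (e i) a.

Lemma link_sym S (x y : dom S) : link x y -> link y x.
Proof.
by case=> r [t [rS [rt [i [j [<- <-]]]]]]; exists r, t; do 2!split=> //; exists j, i.
Qed.

Lemma within0 S d (x : dom S) : within d x x.
Proof. by elim: d => //= d IH; left. Qed.

Lemma within_le S d d' (x y : dom S) : d <= d' -> within d x y -> within d' x y.
Proof.
move=> /subnK <-; elim: (d' - d) => // k IH /IH h.
by rewrite addSn; left.
Qed.

Lemma within_trans S a b (x y z : dom S) :
  within a x y -> within b y z -> within (a + b) x z.
Proof.
elim: b z => [|b IH] z xy /=; first by move=> <-; rewrite addn0.
rewrite addnS; case=> [/(IH _ xy) h | [w [/(IH _ xy) h wz]]]; [by left | right].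
by exists w.
Qed.

Lemma within_sym S d (x y : dom S) : within d x y -> within d y x.
Proof.
elim: d y => //= d IH y [/IH h | [z [/IH h /link_sym yz]]]; first by left.
by apply: (@within_trans _ 1 d y z x) => //=; right; exists y.
Qed.

Lemma near_mono r r' W W' S (e : nat -> dom S) a :
  r <= r' -> (forall i, W i -> W' i) -> near r W e a -> near r' W' e a.
Proof. by move=> rr' WW' [i [/WW' Wi /(within_le rr') h]]; exists i. Qed.

Lemma near_ext r W S (e e' : nat -> dom S) a :
  (forall i, W i -> e i = e' i) -> near r W e a <-> near r W e' a.
Proof. by move=> ee'; split=> -[i [Wi h]]; exists i; rewrite ?ee' // -ee'. Qed.

Lemma near_near r s W i S (e : nat -> dom S) a b :
  near s W e a -> near r (predU1 i W) (assign e i a) b -> ~~ W i -> near (s + r) W e b.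
Proof.
case=> j [Wj ja] [k [/= kW kb]] Wi; case/orP: kW kb => [/eqP -> | Wk].
  by rewrite assign_same => ab; exists j; split=> //; apply: within_trans ja ab.
rewrite assign_other => [kb|]; last by apply: contraNneq Wi => <-.
by exists k; split=> //; apply: within_le kb; rewrite leq_addl.
Qed.

(** Definability is stated for semantic predicates, so that constructions compose without writing
    the formulas out. *)
Definition query := forall S, (nat -> dom S) -> Prop.

(* Evaluating the defining formula in any [D] between the ball around the
   parameters [W] and the whole structure gives the same answer; this makes the
   formula [r]-local and lets it be reused inside relativized formulas. *)
Definition loc_def U W r (Q : query) : Prop :=
  exists phi, wff Sg U phi /\ forall S (D : dom S -> Prop) e,
    (forall a, near r W e a -> D a) -> (sat D e phi <-> Q S e).

Lemma loc_def_iff U W r (Q Q' : query) :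
  (forall S e, Q S e <-> Q' S e) -> loc_def U W r Q -> loc_def U W r Q'.
Proof. by move=> QQ' [f [wf h]]; exists f; split=> // S D e /h ->. Qed.

Lemma loc_def_mono U U' W W' r r' (Q : query) :
  (forall i, U i -> U' i) -> (forall i, W i -> W' i) -> r <= r' ->
  loc_def U W r Q -> loc_def U' W' r' Q.
Proof.
move=> UU' WW' rr' [f [wf h]]; exists f; split; first exact: wff_mono wf.
by move=> S D e nD; apply: h => a na; apply: nD; apply: near_mono na.
Qed.

Lemma loc_def_true U W r : loc_def U W r (fun _ _ => True).
Proof. by exists (FTrue L); split=> // S D e _; split=> // _; apply: sat_FTrue. Qed.

Lemma loc_def_not U W r Q : loc_def U W r Q -> loc_def U W r (fun S e => ~ Q S e).
Proof.
by case=> f [wf h]; exists (FNot f); split=> // S D e /h /= ->.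
Qed.

Lemma loc_def_and U W r Q Q' : loc_def U W r Q -> loc_def U W r Q' ->
  loc_def U W r (fun S e => Q S e /\ Q' S e).
Proof.
case=> f [wf h] [g [wg k]]; exists (FAnd f g); split=> /=; first by rewrite wf.
by move=> S D e nD; rewrite (h _ _ _ nD) (k _ _ _ nD).
Qed.

Lemma loc_def_or U W r Q Q' : loc_def U W r Q -> loc_def U W r Q' ->
  loc_def U W r (fun S e => Q S e \/ Q' S e).
Proof.
case=> f [wf h] [g [wg k]]; exists (FOr f g); split; first by rewrite /= wf.
by move=> S D e nD; rewrite sat_FOr (h _ _ _ nD) (k _ _ _ nD).
Qed.

Lemma loc_def_exists_seq (T : eqType) (s : seq T) U W r (Q : T -> query) :
  (forall x, x \in s -> loc_def U W r (Q x)) ->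
  loc_def U W r (fun S e => exists2 x, x \in s & Q x S e).
Proof.
elim: s => [|x s IH] h.
  by apply: loc_def_iff (loc_def_not (loc_def_true U W r)) => S e; split=> [[]|[]].
have h1 : loc_def U W r (Q x) by apply: h; rewrite inE eqxx.
have h2 : loc_def U W r (fun S e => exists2 x, x \in s & Q x S e).
  by apply: IH => y ys; apply: h; rewrite inE ys orbT.
apply: loc_def_iff (loc_def_or h1 h2) => S e; split.
  case=> [Qx | [y ys Qy]]; first by exists x; rewrite ?inE ?eqxx.
  by exists y; rewrite ?inE ?ys ?orbT.
case=> y; rewrite inE => /orP[/eqP -> | ys] Qy; first by left.
by right; exists y.
Qed.

Lemma loc_def_eq i j : loc_def (pred2 i j) (pred1 i) 0 (fun S e => e i = e j).
Proof. by exists (FEq i j); split=> //=; rewrite !eqxx orbT. Qed.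

(** Every entry of a tuple through [e i] is linked to [e i], so the whole tuple can be sought in the
    ball of radius 1. *)
Lemma loc_def_link i j :
  loc_def (pred2 i j) (pred1 i) 1 (fun S e => link (e i) (e j)).
Proof.
have [f [wf h]] : loc_def (pred2 i j) (pred1 i) 1 (fun S e =>
    exists2 r, r \in Sg & exists t : (arity r).-tuple (dom S), Defs.rel t /\
      exists a b : 'I_(arity r), tnth t a = e i /\ tnth t b = e j).
  apply: loc_def_exists_seq => r rS; set m := (i + j).+1.
  pose V k := pred2 i j k || (m <= k < m + arity r).
  (* The entries of the tuple are the variables from [m] on, all beyond [i] and [j]; a finite
     disjunction says that the value of [x] is one of them. *)
  have occ x : pred2 i j x -> exists f, wff Sg V f /\ forall S (D : dom S -> Prop) e,
      sat D e f <-> exists a : 'I_(arity r), e (m + a) = e x.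
    move=> ijx; suff : exists f, wff Sg V f /\ forall S (D : dom S -> Prop) e,
      sat D e f <-> exists2 a : 'I_(arity r), a \in enum 'I_(arity r) & e (m + a) = e x.
      case=> f [wf h]; exists f; split=> // S D e; rewrite h.
      by split=> [[a _]|[a]] ea; exists a; rewrite ?mem_enum.
    elim: (enum _) => [|a s [f [wf h]]].
      by exists (FNot (FTrue L)); split=> // S D e; split=> [[]|[//]]; apply: sat_FTrue.
    exists (FOr (FEq (m + a) x) f); split=> [|S D e].
      by rewrite /= wf andbT /V ijx andbT; apply/orP; right; have := ltn_ord a; lia.
    rewrite sat_FOr h /=; split.
      by case=> [ea | [b bs eb]]; [exists a | exists b]; rewrite ?inE ?eqxx ?bs ?orbT.
    case=> b; rewrite inE => /orP[/eqP -> | bs] eb; [by left | by right; exists b].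
  have [f [wf hf]] := occ i ltac:(by rewrite /= eqxx).
  have [g [wg hg]] := occ j ltac:(by rewrite /= eqxx orbT).
  pose t := [tuple m + k | k < arity r].
  exists (FExs m (arity r) (FAnd (FRel t) (FAnd f g))); split.
    apply: wff_FExs; rewrite /= rS wf wg !andbT /=; apply/allP => k.
    by case/mapP => a _ ->; apply/orP; right; have := ltn_ord a; lia.
  move=> S D e nD; rewrite sat_FExs.
  have mi : (m <= i < m + arity r) = false by lia.
  have mj : (m <= j < m + arity r) = false by lia.
  have ma (a : 'I_(arity r)) : m <= m + a < m + arity r by have := ltn_ord a; lia.
  split.
    case=> u [Du /= [rt []]]; rewrite hf hg mi mj => -[a ea] [b eb].
    exists (map_tuple (fun k => if m <= k < m + arity r then u k else e k) t).
    by split=> //; exists a, b; rewrite !tnth_map tnth_ord_tuple -ea -eb !tnth_ord_tuple.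
  case=> u [ru [a [b [ea eb]]]]; exists (fun k => nth (e i) u (k - m)).
  have tu (k : 'I_(arity r)) : nth (e i) u (m + k - m) = tnth u k.
    by rewrite addKn -tnth_nth.
  split.
    move=> k hk; have lt : k - m < arity r by lia.
    apply: nD; exists i; split=> /=; first exact: eqxx.
    right; exists (e i); split=> //; exists r, u; do 2!split=> //.
    by exists a, (Ordinal lt); rewrite ea (tnth_nth (e i)).
  rewrite /= hf hg mi mj; split.
    congr Defs.rel: ru; apply: eq_from_tnth => k.
    by rewrite !tnth_map tnth_ord_tuple ma tu.
  by split; [exists a | exists b]; rewrite ma tu.
exists f; split=> // S D e /h ->; split.
  by case=> r rS [t [rt ab]]; exists r, t.
by case=> r [t [rS [rt ab]]]; exists r => //; exists t.
Qed.

(** The walk to [e j] is cut before its last step. The intermediate point lies within [d] of [e i],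
    so the radius 1 needed for the last link stays within [d.+1], and [i] alone serves as centre. *)
Lemma loc_def_within d i j :
  loc_def (pred2 i j) (pred1 i) d (fun S e => within d (e i) (e j)).
Proof.
elim: d j => [|d IH] j /=; first exact: loc_def_eq.
pose z := (i + j).+1.
have [f [wf hf]] := IH j; have [g [wg hg]] := IH z; have [h [wh hh]] := loc_def_link z j.
exists (FOr f (FEx z (FAnd g h))); split.
  rewrite /= wf /=; apply/andP; split.
    by apply: wff_mono wg => k /= /orP[] ->; rewrite ?orbT.
  by apply: wff_mono wh => k /= /orP[] ->; rewrite ?orbT.
move=> S D e nD; rewrite sat_FOr.
have zi : i != z by rewrite /z; lia.
have zj : j != z by rewrite /z; lia.
have nD' a : near d (pred1 i) e a -> D a.
  by move=> na; apply: nD; apply: near_mono na.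
have hga a : sat D (assign e z a) g <-> within d (e i) a.
  rewrite hg ?assign_same ?assign_other // => b nb; apply: nD'.
  by rewrite (@near_ext _ _ _ e (assign e z a)) // => k /eqP ->; rewrite assign_other.
have hha a : within d (e i) a -> sat D (assign e z a) h <-> link a (e j).
  move=> wa; rewrite hh ?assign_same ?assign_other // => b [k [/eqP -> ]].
  rewrite assign_same => ab; apply: nD; exists i; split; first exact: eqxx.
  by rewrite -addn1; apply: within_trans wa ab.
rewrite hf //; split.
  case=> [|[a [Da [/hga wa /(hha _ wa) la]]]]; first by left.
  by right; exists a.
case=> [|[a [wa la]]]; first by left.
right; exists a; split; first by apply: nD'; exists i; split=> //=; apply: eqxx.
by split; [apply/hga | apply/hha].
Qed.

(** The bound [m] makes [W] finite, so the union of balls becomes a finite disjunction. *)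
Lemma loc_def_near r W m k : (forall i, W i -> i < m) ->
  loc_def (predU1 k W) W r (fun S e => near r W e (e k)).
Proof.
move=> Wm.
suff h : loc_def (predU1 k W) W r
    (fun S e => exists2 i, i \in filter W (iota 0 m) & within r (e i) (e k)).
  apply: loc_def_iff h => S e; split=> [[i]|[i [Wi h]]].
    by rewrite mem_filter => /andP[Wi _] h; exists i.
  by exists i => //; rewrite mem_filter Wi mem_iota /= add0n Wm.
apply: loc_def_exists_seq => i; rewrite mem_filter => /andP[Wi _].
apply: loc_def_mono (loc_def_within r i k) => //= j.
  by case/orP => /eqP ->; rewrite ?eqxx ?Wi ?orbT.
by move/eqP ->.
Qed.

(** Radii add up: the [r]-ball of a witness near [W] stays within [s + r] of [W]. Since [i] is not
    in [W], assigning it leaves the old centres in place. *)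
Lemma loc_def_exists_near U W m s r i (Q : query) :
  (forall j, W j -> j < m) -> (forall j, W j -> U j) -> ~~ W i ->
  loc_def (predU1 i U) (predU1 i W) r Q ->
  loc_def U W (s + r) (fun S e => exists a, near s W e a /\ Q S (assign e i a)).
Proof.
move=> Wm WU Wi [f [wf hf]]; have [g [wg hg]] := loc_def_near s i Wm.
exists (FEx i (FAnd g f)); split=> /=.
  rewrite wf andbT; apply: wff_mono wg => k /= /orP[->//|/WU ->]; exact: orbT.
move=> S D e nD.
have iW a k : W k -> assign e i a k = e k.
  by move=> Wk; apply: assign_other; apply: contraNneq Wi => <-.
have nD' a : near s W e a -> D a.
  by move=> na; apply: nD; apply: near_mono na; rewrite ?leq_addr.
have hga a : sat D (assign e i a) g <-> near s W e a.
  rewrite hg ?assign_same; first by apply: near_ext => k; apply: iW.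
  by move=> b nb; apply: nD'; rewrite (@near_ext _ _ _ e (assign e i a)) // => k /iW.
have hfa a : near s W e a -> sat D (assign e i a) f <-> Q S (assign e i a).
  by move=> na; apply: hf => b nb; apply: nD; apply: near_near na nb Wi.
split; first by case=> a [Da [/hga na /(hfa _ na) Qa]]; exists a.
case=> a [na Qa]; exists a; split; first exact: nD'.
by split; [apply/hga | apply/hfa].
Qed.

(** Restricting every quantifier to the ball makes the value independent of [D]. A bound variable
    could capture a centre in [W], so a renaming [rho] is carried along and each bound variable is
    sent to a fresh [m]. *)
Lemma loc_def_relativize phi r V W U rho m :
  wff Sg V phi -> (forall i, V i -> U (rho i)) -> (forall i, W i -> U i) ->
  (forall i, U i -> i < m) ->
  loc_def U W r (fun S e => sat (near r W e) (e \o rho) phi).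
Proof.
elim: phi V U rho m => /=.
- move=> i j V U rho m /andP[Vi Vj] VU WU Um.
  by exists (FEq (rho i) (rho j)); split=> //=; rewrite !VU.
- move=> s t V U rho m /andP[sS /allP Vt] VU WU Um.
  exists (FRel (map_tuple rho t)); split=> /=.
    by rewrite sS; apply/allP => k /mapP[i /Vt Vi ->]; apply: VU.
  move=> S D e _; suff -> : map_tuple e (map_tuple rho t) = map_tuple (e \o rho) t by [].
  by apply: val_inj => /=; rewrite -map_comp.
- by move=> f IH V U rho m wf VU WU Um; apply: loc_def_not; apply: IH wf VU WU Um.
- move=> f IHf g IHg V U rho m /andP[wf wg] VU WU Um.
  by apply: loc_def_and; [apply: IHf wf VU WU Um | apply: IHg wg VU WU Um].
- move=> i f IH V U rho m wf VU WU Um.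
  have Wm j : W j -> j < m by move/WU/Um.
  have [] := IH _ (predU1 m U) (assign rho i m) m.+1 wf.
  + move=> j /= /orP[/eqP ->|Vj]; first by rewrite assign_same eqxx.
    by rewrite /assign; case: (eqVneq j i) => _; rewrite ?eqxx ?VU ?orbT.
  + by move=> j /= /WU ->; rewrite orbT.
  + by move=> j /= /orP[/eqP -> // | /Um]; lia.
  move=> f' [wf' hf']; have [g [wg hg]] := loc_def_near r m Wm.
  exists (FEx m (FAnd g f')); split=> /=.
    rewrite wf' andbT; apply: wff_mono wg => k /= /orP[->//|/WU ->]; exact: orbT.
  move=> S D e nD.
  have mW a k : W k -> assign e m a k = e k.
    by move/Wm => km; apply: assign_other; lia.
  have nE a b : near r W (assign e m a) b <-> near r W e b.
    by apply: near_ext => k; apply: mW.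
  have hga a : sat D (assign e m a) g <-> near r W e a.
    by rewrite hg ?assign_same ?nE // => b /nE /nD.
  have hfa a : sat D (assign e m a) f' <-> sat (near r W e) (assign (e \o rho) i a) f.
    rewrite hf' => [|b /nE /nD //]; apply: (sat_ext wf) => [j /= jV | b]; last exact: nE.
    rewrite /assign; case: (eqVneq j i) jV => [->|ji] /= Vj; first by rewrite eqxx.
    by case: eqP (Um _ (VU _ Vj)) => // ->; rewrite ltnn.
  split; first by case=> a [Da [/hga na /hfa sa]]; exists a.
  by case=> a [na /hfa sa]; exists a; split; [apply: nD | split=> //; apply/hga].
Qed.


(** * Splitting formulas over two unlinked sets *)

Definition unlinked S (D1 D2 : dom S -> Prop) : Prop :=
  forall x y, D1 x -> D2 y -> x <> y /\ ~ link x y.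

Fixpoint sat_pairs S (D1 D2 : dom S -> Prop) e (l : seq (formula L * formula L)) : Prop :=
  if l is p :: l' then (sat D1 e p.1 /\ sat D2 e p.2) \/ sat_pairs D1 D2 e l'
  else False.

Definition wff_pairs V1 V2 (l : seq (formula L * formula L)) : bool :=
  all (fun p => wff Sg V1 p.1 && wff Sg V2 p.2) l.

Definition pairs_and1 (p : formula L * formula L) l :=
  [seq (FAnd p.1 q.1, FAnd p.2 q.2) | q <- l].

Fixpoint pairs_and l1 l2 :=
  if l1 is p :: l1' then pairs_and1 p l2 ++ pairs_and l1' l2 else [::].

(** A disjunction of pairs fails when each pair fails on one of its sides; the list runs through all
    choices of failing sides. *)
Fixpoint pairs_not l :=
  if l is p :: l' then
    pairs_and1 (FNot p.1, FTrue L) (pairs_not l') ++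
    pairs_and1 (FTrue L, FNot p.2) (pairs_not l')
  else [:: (FTrue L, FTrue L)].

Lemma sat_pairs_cat S (D1 D2 : dom S -> Prop) e l1 l2 :
  sat_pairs D1 D2 e (l1 ++ l2) <-> sat_pairs D1 D2 e l1 \/ sat_pairs D1 D2 e l2.
Proof. by elim: l1 => [|p l1 IH] /=; [|rewrite IH]; tauto. Qed.

Lemma sat_pairs_and1 S (D1 D2 : dom S -> Prop) e p l :
  sat_pairs D1 D2 e (pairs_and1 p l) <->
  (sat D1 e p.1 /\ sat D2 e p.2) /\ sat_pairs D1 D2 e l.
Proof. by elim: l => [|q l IH] /=; [|rewrite IH]; tauto. Qed.

Lemma sat_pairs_and S (D1 D2 : dom S -> Prop) e l1 l2 :
  sat_pairs D1 D2 e (pairs_and l1 l2) <->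
  sat_pairs D1 D2 e l1 /\ sat_pairs D1 D2 e l2.
Proof.
elim: l1 => [|p l1 IH] /=; first tauto.
by rewrite sat_pairs_cat sat_pairs_and1 IH; tauto.
Qed.

Lemma sat_pairs_not S (D1 D2 : dom S -> Prop) e l :
  sat_pairs D1 D2 e (pairs_not l) <-> ~ sat_pairs D1 D2 e l.
Proof.
have T (D : dom S -> Prop) := @sat_FTrue _ _ D e.
elim: l => [|p l IH]; first by split=> [_ []|_]; left; split; apply: T.
rewrite [pairs_not _]/= sat_pairs_cat !sat_pairs_and1 IH /fst /snd.
have -> : sat_pairs D1 D2 e (p :: l) =
  ((sat D1 e p.1 /\ sat D2 e p.2) \/ sat_pairs D1 D2 e l) by [].
have := T D1; have := T D2; rewrite [sat D1 e (FNot _)]/= [sat D2 e (FNot _)]/=.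
by case: (classic (sat D1 e p.1)); case: (classic (sat D2 e p.2)); tauto.
Qed.

Lemma wff_pairs_and1 V1 V2 p l : wff Sg V1 p.1 -> wff Sg V2 p.2 ->
  wff_pairs V1 V2 l -> wff_pairs V1 V2 (pairs_and1 p l).
Proof.
rewrite /wff_pairs all_map => w1 w2 wl; apply: sub_all wl => q /=.
by rewrite w1 w2.
Qed.

Lemma wff_pairs_and V1 V2 l1 l2 :
  wff_pairs V1 V2 l1 -> wff_pairs V1 V2 l2 -> wff_pairs V1 V2 (pairs_and l1 l2).
Proof.
move=> w1 w2; elim: l1 w1 => //= p l1 IH /andP[/andP[p1 p2] /IH wl].
by rewrite /wff_pairs all_cat; apply/andP; split=> //; apply: wff_pairs_and1.
Qed.

Lemma wff_pairs_not V1 V2 l : wff_pairs V1 V2 l -> wff_pairs V1 V2 (pairs_not l).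
Proof.
elim: l => //= p l IH /andP[/andP[p1 p2] /IH wl].
by rewrite /wff_pairs all_cat; apply/andP; split; apply: wff_pairs_and1.
Qed.

Lemma wff_pairs_mono V1 V2 U1 U2 l : (forall i, V1 i -> U1 i) -> (forall i, V2 i -> U2 i) ->
  wff_pairs V1 V2 l -> wff_pairs U1 U2 l.
Proof.
move=> h1 h2; apply: sub_all => p /andP[w1 w2].
by rewrite (wff_mono h1) ?(wff_mono h2).
Qed.

(** [X] marks the free variables with values in [D1]. Atoms with variables on both sides are false,
    because the sets are disjoint and no tuple of a relation in [Sg] meets both. Connectives are
    computed on the lists, and a quantifier ranges over one set or the other. *)
Lemma feferman_vaught phi V X : wff Sg V phi ->
  exists l, wff_pairs (predI V X) (predD V X) l /\
    forall S (D1 D2 : dom S -> Prop) e, unlinked D1 D2 ->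
    (forall i, V i -> if X i then D1 (e i) else D2 (e i)) ->
    (sat (fun a => D1 a \/ D2 a) e phi <-> sat_pairs D1 D2 e l).
Proof.
have T S (D : dom S -> Prop) e := @sat_FTrue _ _ D e.
elim: phi V X.
- move=> i j V X /= /andP[Vi Vj]; case Xi: (X i); case Xj: (X j).
  + exists [:: (FEq i j, FTrue L)]; rewrite /wff_pairs /= Vi Vj Xi Xj; split=> //.
    by move=> S D1 D2 e _ _; have /= := T S D2 e; tauto.
  + exists [::]; split=> // S D1 D2 e un hV; split=> //=.
    have := hV _ Vi; have := hV _ Vj; rewrite Xi Xj => d2 d1.
    by case: (un _ _ d1 d2).
  + exists [::]; split=> // S D1 D2 e un hV; split=> //=.
    have := hV _ Vi; have := hV _ Vj; rewrite Xi Xj => d1 d2 /esym.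
    by case: (un _ _ d1 d2).
  + exists [:: (FTrue L, FEq i j)]; rewrite /wff_pairs /= Vi Vj Xi Xj; split=> //.
    by move=> S D1 D2 e _ _; have /= := T S D1 e; tauto.
- move=> r t V X /= /andP[rS /allP Vt].
  have [tX|] := boolP (all X t).
    exists [:: (FRel t, FTrue L)]; rewrite /wff_pairs /= rS andbT; split.
      rewrite andbT; apply/allP => x xt /=; rewrite Vt //; exact: (allP tX).
    by move=> S D1 D2 e _ _; have /= := T S D2 e; tauto.
  case/allPn => x xt Xx.
  have [tX|] := boolP (all (predC X) t).
    exists [:: (FTrue L, FRel t)]; rewrite /wff_pairs /= rS andbT; split.
      by apply/allP => y yt /=; rewrite Vt // andbT; apply: (allP tX).
    by move=> S D1 D2 e _ _; have /= := T S D1 e; tauto.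
  case/allPn => y yt; rewrite /= negbK => Xy.
  (* The variables occur on both sides, so a true atom would link [D1] with [D2]; the answer is the
     empty disjunction. *)
  exists [::]; split=> // S D1 D2 e un hV; split=> //= ret.
  have := hV _ (Vt _ xt); have := hV _ (Vt _ yt); rewrite Xy (negbTE Xx) => d1 d2.
  case: (un _ _ d1 d2) => _; apply; exists r, (map_tuple e t); do 2!split=> //.
  have /tnthP[a ->] := yt; have /tnthP[b ->] := xt.
  by exists a, b; rewrite !tnth_map.
- move=> f IH V X /= /(IH V X) [l [wl h]]; exists (pairs_not l).
  split; first exact: wff_pairs_not.
  by move=> S D1 D2 e un hV; rewrite sat_pairs_not h.
- move=> f IHf g IHg V X /= /andP[/(IHf V X) [l [wl h]] /(IHg V X) [l' [wl' h']]].
  exists (pairs_and l l'); split; first exact: wff_pairs_and.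
  by move=> S D1 D2 e un hV; rewrite sat_pairs_and h // h'.
- move=> i f IH V X /= wf.
  (* Witnesses in [D1] are handled by [l1], those in [D2] by [l2]. An outer value of [i] is
     shadowed, so [i] is put into or taken out of [X] regardless of its earlier side. *)
  have [l1 [w1 h1]] := IH _ (predU1 i X) wf.
  have [l2 [w2 h2]] := IH _ (predD1 X i) wf.
  have w1' : wff_pairs (predI (predU1 i V) (predU1 i X)) (predD V X) l1.
    apply: wff_pairs_mono w1 => //= k; rewrite /=; case: (eqVneq k i) => //.
  have w2' : wff_pairs (predI V X) (predI (predU1 i V) (predC (predD1 X i))) l2.
    apply: wff_pairs_mono w2 => //= k; first by rewrite /=; case: (eqVneq k i).
    by rewrite andbC.
  exists ([seq (FEx i p.1, p.2) | p <- l1] ++ [seq (p.1, FEx i p.2) | p <- l2]); split.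
    rewrite /wff_pairs all_cat !all_map; apply/andP; split.
      apply: sub_all w1' => p /= /andP[p1 ->]; rewrite andbT.
      by apply: wff_mono p1 => k /=; case: eqP.
    apply: sub_all w2' => p /= /andP[-> p2] /=; apply: wff_mono p2 => k /=.
    by rewrite negb_and negbK andbC; case: eqP.
  move=> S D1 D2 e un hV; rewrite sat_pairs_cat.
  (* The component on the other side does not mention [i], so the quantifier can be moved onto a
     single component. *)
  have frame V1 (D : dom S -> Prop) g a :
      (forall k, V1 k -> k != i) -> wff Sg V1 g -> sat D (assign e i a) g <-> sat D e g.
    by move=> ne wg; apply: (sat_ext wg) => // k /ne ki; rewrite assign_other.
  have E1 : sat_pairs D1 D2 e [seq (FEx i p.1, p.2) | p <- l1] <->
      exists a, D1 a /\ sat_pairs D1 D2 (assign e i a) l1.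
    elim: l1 w1 {w1' h1} => [_|p l1 IHl /andP[/andP[_ p2] /IHl wl]] /=.
      by split=> [[]|[a []]].
    have F a : sat D2 (assign e i a) p.2 <-> sat D2 e p.2.
      by apply: frame p2 => k /=; rewrite negb_or => /andP[/andP[]].
    rewrite wl; split.
      by case=> [[[a [Da sa]] s2]|[a [Da sa]]]; exists a; have := F a; tauto.
    case=> a [Da [[s1 /(F a) s2]|sa]]; [left; split=> //|right]; by exists a.
  have E2 : sat_pairs D1 D2 e [seq (p.1, FEx i p.2) | p <- l2] <->
      exists a, D2 a /\ sat_pairs D1 D2 (assign e i a) l2.
    elim: l2 w2 {w2' h2} => [_|p l2 IHl /andP[/andP[p1 _] /IHl wl]] /=.
      by split=> [[]|[a []]].
    have F a : sat D1 (assign e i a) p.1 <-> sat D1 e p.1.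
      by apply: frame p1 => k /= => /andP[_ /andP[]].
    rewrite wl; split.
      by case=> [[s1 [a [Da sa]]]|[a [Da sa]]]; exists a; have := F a; tauto.
    case=> a [Da [[/(F a) s1 s2]|sa]]; [left; split=> //|right]; by exists a.
  have F1 a : D1 a -> sat (fun b => D1 b \/ D2 b) (assign e i a) f <->
      sat_pairs D1 D2 (assign e i a) l1.
    move=> Da; apply: h1 => // k /=; case: (eqVneq k i) => [-> _|ki /= Vk].
      by rewrite assign_same.
    by rewrite assign_other //; apply: hV.
  have F2 a : D2 a -> sat (fun b => D1 b \/ D2 b) (assign e i a) f <->
      sat_pairs D1 D2 (assign e i a) l2.
    move=> Da; apply: h2 => // k /=; case: (eqVneq k i) => [-> _|ki /= Vk].
      by rewrite assign_same.
    by rewrite assign_other //; apply: hV.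
  rewrite E1 E2 /=; split.
    by case=> a [[Da|Da] sa]; [left|right]; exists a; split=> //; [apply/F1|apply/F2].
  by case=> -[a [Da sa]]; exists a; (split; first by auto); [apply/F1|apply/F2].
Qed.

(** * Scattered sets *)

Fixpoint scattered (c : nat) (B : forall S, dom S -> Prop) S (l : seq (dom S)) : Prop :=
  if l is a :: l' then
    B S a /\ List.Forall (fun b => ~ within c a b) l' /\ scattered c B l'
  else True.

(** Two points in the same [c]-ball are within [c + c] of each other, so different entries of the
    list use different centres, of which there are at most [m]. *)
Lemma scattered_size c B S e W m (l : seq (dom S)) :
  (forall i, W i -> i < m) -> List.Forall (near c W e) l ->
  scattered (c + c) B l -> size l <= m.
Proof.
move=> Wm nl sl.
suff [js [<- ujs jm _]] : exists js : seq nat, [/\ size js = size l, uniq js,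
    {subset js <= iota 0 m} &
    forall j, j \in js -> exists b, List.In b l /\ within c (e j) b].
  by rewrite -[leqRHS](size_iota 0); apply: uniq_leq_size.
elim: l nl sl => [|a l IH] nl /=; first by exists [::].
case=> _ [/List.Forall_forall al /IH].
move/List.Forall_cons_iff: nl => [[i [Wi ia]] nl] [//|js [sz ujs jm jsl]].
exists (i :: js); split=> /=; first by rewrite sz.
- rewrite ujs andbT; apply/negP => /jsl [b [bl ib]].
  by apply: (al _ bl); apply: within_trans (within_sym ia) ib.
- by move=> j; rewrite inE => /orP[/eqP -> | /jm //]; rewrite mem_iota /= Wm.
move=> j; rewrite inE => /orP[/eqP -> | /jsl [b [bl jb]]]; first by exists a; auto.
by exists b; auto.
Qed.

Lemma loc_def_scattered r c (B : forall S, dom S -> Prop) U vs :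
  (forall x, loc_def (pred1 x) (pred1 x) r (fun S e => B S (e x))) -> all U vs ->
  loc_def U U (maxn r c) (fun S e => scattered c B (map e vs)).
Proof.
move=> Bd; elim: vs => [|x vs IH] /=; first by move=> _; apply: loc_def_true.
case/andP=> Ux Uvs; apply: loc_def_and.
  by apply: loc_def_mono (Bd x) => [i /eqP ->|i /eqP ->|]; rewrite ?leq_maxl.
apply: loc_def_and (IH Uvs).
elim: vs {IH} Uvs => [_|y vs IH /= /andP[Uy /IH h]].
  by apply: loc_def_iff (loc_def_true _ _ _) => S e; split.
have w : loc_def U U (maxn r c) (fun S e => ~ within c (e x) (e y)).
  apply: loc_def_not; apply: loc_def_mono (loc_def_within c x y) => [i|i|].
  - by case/orP=> /eqP ->.
  - by move/eqP ->.
  - exact: leq_maxr.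
by apply: loc_def_iff (loc_def_and w h) => S e; rewrite List.Forall_cons_iff.
Qed.

(* Instantiated with [K] being local definability and [P] a ball, and with [K]
   being definability in the whole structure and [P] always true. *)
Lemma definable_scattered (K : pred nat -> query -> Prop) W
    (P : forall S, (nat -> dom S) -> dom S -> Prop) c (B : forall S, dom S -> Prop) :
  (forall U Q Q', (forall S e, Q S e <-> Q' S e) -> K U Q -> K U Q') ->
  (forall U vs, all U vs -> K U (fun S e => scattered c B (map e vs))) ->
  (forall U m Q, (forall i, U i -> i < m) -> (forall i, W i -> U i) ->
     K (predU1 m U) Q -> K U (fun S e => exists a, P S e a /\ Q S (assign e m a))) ->
  (forall S e i a b, ~~ W i -> P S (assign e i a) b <-> P S e b) ->
  forall k U m vs, (forall i, U i -> i < m) -> (forall i, W i -> U i) -> all U vs ->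
  K U (fun S e => exists l, size l = k /\ List.Forall (P S e) l /\
                            scattered c B (l ++ map e vs)).
Proof.
move=> Kiff Kbase Kex Pext; elim=> [|k IH] U m vs Um WU Uvs.
  apply: Kiff (Kbase _ _ Uvs) => S e; split=> [h|[l [/size0nil -> [_]]] //].
  by exists [::].
(* The new variable heads [vs], so its value stands right after [l] and the list of witnesses
   becomes [rcons l a]. *)
have {}IH := IH (predU1 m U) m.+1 (m :: vs) _ _ _.
have {}IH := Kex _ _ _ Um WU (IH _ _ _).
have mW : ~~ W m by apply/negP => /WU /Um; rewrite ltnn.
have E S (e : nat -> dom S) a : map (assign e m a) (m :: vs) = a :: map e vs.
  rewrite /= assign_same; congr cons; apply/eq_in_map => i /(allP Uvs) /Um im.
  by rewrite assign_other // ltn_eqF.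
apply: Kiff (IH _ _ _) => [S e|i /= /orP[/eqP -> // | /Um]|i /WU /= ->|/=].
- split.
    case=> a [Pa [l [sl [Pl sc]]]]; exists (rcons l a); rewrite size_rcons sl; split=> //.
    rewrite E in sc; rewrite cat_rcons; split=> //; rewrite -cats1.
    apply/List.Forall_app; split; last by constructor.
    by apply: List.Forall_impl Pl => b /Pext; apply.
  case=> l; case/lastP: l => [|l a] [//]; rewrite size_rcons => -[sl].
  rewrite cat_rcons -cats1 => -[/List.Forall_app [Pl /List.Forall_cons_iff [Pa _]] sc].
  exists a; split=> //; exists l; rewrite E; do 2!split=> //.
  by apply: List.Forall_impl Pl => b Pb; apply/Pext.
- by move=> im; apply: ltnW.
- by rewrite orbT.
- by rewrite eqxx /=; apply: sub_all Uvs => i /= ->; rewrite orbT.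
Qed.

(** * Local definability with unspecified radius *)

Definition ldef U (Q : query) : Prop := exists r, loc_def U U r Q.

Lemma ldef_iff U (Q Q' : query) : (forall S e, Q S e <-> Q' S e) -> ldef U Q -> ldef U Q'.
Proof. by move=> h [r d]; exists r; apply: loc_def_iff d. Qed.

Lemma ldef_mono U U' Q : (forall i, U i -> U' i) -> ldef U Q -> ldef U' Q.
Proof. by move=> h [r d]; exists r; apply: loc_def_mono d. Qed.

Lemma ldef_not U Q : ldef U Q -> ldef U (fun S e => ~ Q S e).
Proof. by move=> [r d]; exists r; apply: loc_def_not. Qed.

Lemma ldef_and U Q Q' : ldef U Q -> ldef U Q' -> ldef U (fun S e => Q S e /\ Q' S e).
Proof.
move=> [r d] [r' d']; exists (maxn r r').
by apply: loc_def_and; [apply: loc_def_mono d | apply: loc_def_mono d'];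
  rewrite ?leq_maxl ?leq_maxr.
Qed.

Lemma ldef_or U Q Q' : ldef U Q -> ldef U Q' -> ldef U (fun S e => Q S e \/ Q' S e).
Proof.
move=> [r d] [r' d']; exists (maxn r r').
by apply: loc_def_or; [apply: loc_def_mono d | apply: loc_def_mono d'];
  rewrite ?leq_maxl ?leq_maxr.
Qed.

Lemma ldef_exists_near W s U m (Q : query) :
  (forall i, U i -> i < m) -> (forall i, W i -> U i) -> ldef (predU1 m U) Q ->
  ldef U (fun S e => exists a, near s W e a /\ Q S (assign e m a)).
Proof.
move=> Um WU dQ.
have Wm i : W i -> i < m by move/WU/Um.
have mU : ~~ U m by apply/negP => /Um; rewrite ltnn.
(* The body has all of [U] among its centres, so the witness is sought around [U]; its restriction
   to the ball around [W] becomes part of the body. *)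
have nd : ldef (predU1 m U) (fun S e => near s W e (e m)).
  by exists s; apply: loc_def_mono (loc_def_near s m Wm) => // i /=;
    [case/orP=> [->|/WU ->] | move/WU ->]; rewrite ?orbT.
have [r d] := ldef_and nd dQ.
exists (s + r); have h := @loc_def_exists_near U U m s r m _ Um (fun _ h => h) mU d.
apply: loc_def_iff h => S e.
have E a : near s W (assign e m a) (assign e m a m) <-> near s W e a.
  by rewrite assign_same; apply: near_ext => i /Wm im; rewrite assign_other // ltn_eqF.
split; first by case=> a [_ [/E na Qa]]; exists a.
by case=> a [na Qa]; exists a; split; [apply: near_mono na | split=> //; apply/E].
Qed.

End Locality.

(** * Eventual local definability along the sequence *)

Section EventualLocality.

Variables (L : signature) (Sg : seq (sym L)) (A : nat -> finStructure L).

Notation struct n := (struct_of (A n)).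

Definition eventually_const (P : nat -> Prop) : Prop :=
  (exists N, forall n, N <= n -> P n) \/ (exists N, forall n, N <= n -> ~ P n).

(** Sentences ignore the assignment and domains are nonempty, so the negation of [forall e] means
    that the sentence is false. *)
Hypothesis sentences_const : forall phi, wff Sg pred0 phi ->
  eventually_const (fun n => forall e, sat (whole (S := struct n)) e phi).

Implicit Types (U V W : pred nat) (Q : query L).

(** The local query may depend on the eventual truth values of sentences, so agreement can be
    required only from some index on. *)
Definition ev_ldef V Q : Prop :=
  exists Q' N, ldef Sg V Q' /\
    forall n, N <= n -> forall e : nat -> dom (struct n), Q _ e <-> Q' _ e.

Lemma ev_ldef_of V Q : ldef Sg V Q -> ev_ldef V Q.
Proof. by move=> d; exists Q, 0. Qed.

Lemma ev_ldef_iff V Q Q' : (exists N, forall n, N <= n ->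
  forall e : nat -> dom (struct n), Q' _ e <-> Q _ e) -> ev_ldef V Q -> ev_ldef V Q'.
Proof.
case=> N QQ' [Q1 [M [d h]]]; exists Q1, (maxn N M); split=> // n.
by rewrite geq_max => /andP[/QQ' hn /h kn] e; rewrite hn kn.
Qed.

Lemma ev_ldef_mono V V' Q : (forall i, V i -> V' i) -> ev_ldef V Q -> ev_ldef V' Q.
Proof. by move=> h [Q' [N [/(ldef_mono h) d k]]]; exists Q', N. Qed.

Lemma ev_ldef_not V Q : ev_ldef V Q -> ev_ldef V (fun S e => ~ Q S e).
Proof.
by move=> [Q' [N [/ldef_not d k]]]; eexists _, N; split; [exact: d|] => n /k h e; rewrite h.
Qed.

Lemma ev_ldef_and V Q1 Q2 : ev_ldef V Q1 -> ev_ldef V Q2 ->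
  ev_ldef V (fun S e => Q1 S e /\ Q2 S e).
Proof.
move=> [Q1' [N [d h]]] [Q2' [M [d' k]]]; eexists _, (maxn N M).
split; [exact: ldef_and d d'|] => n.
by rewrite geq_max => /andP[/h hn /k kn] e; rewrite hn kn.
Qed.

Lemma ev_ldef_or V Q1 Q2 : ev_ldef V Q1 -> ev_ldef V Q2 ->
  ev_ldef V (fun S e => Q1 S e \/ Q2 S e).
Proof.
move=> [Q1' [N [d h]]] [Q2' [M [d' k]]]; eexists _, (maxn N M).
split; [exact: ldef_or d d'|] => n.
by rewrite geq_max => /andP[/h hn /k kn] e; rewrite hn kn.
Qed.

Definition some_scattered c (B : forall S : structure L, dom S -> Prop) k S : Prop :=
  exists l : seq (dom S), size l = k /\ scattered Sg c B l.

(** For fixed [k], the existence of such a set is a single sentence, a basic local sentence in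
    Gaifman's sense. *)
Lemma some_scattered_const r c (B : forall S : structure L, dom S -> Prop) k :
  (forall x, loc_def Sg (pred1 x) (pred1 x) r (fun S e => B S (e x))) ->
  eventually_const (fun n => some_scattered c B k (struct n)).
Proof.
move=> Bd; pose K U (Q : query L) := exists phi, wff Sg U phi /\
  forall S e, sat (whole (S := S)) e phi <-> Q S e.
have [|U vs Uvs|U m Q Um _|//|phi [wphi hphi]] :=
  @definable_scattered L Sg K pred0 (fun _ _ _ => True) c B _ _ _ _ k pred0 0 [::]
    ltac:(by []) (fun _ h => h) isT.
- by move=> U Q Q' QQ' [f [wf h]]; exists f; split=> // S e; rewrite h.
- by have [f [wf h]] := loc_def_scattered c Bd Uvs; exists f; split=> // S e; apply: h.
- case=> f [wf h]; exists (FEx m f); split=> // S e /=.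
  by split=> -[a [_ sa]]; exists a; split=> //; apply/h.
have E n (e : nat -> dom (struct n)) :
    sat (whole (S := struct n)) e phi <-> some_scattered c B k (struct n).
  rewrite hphi; split=> -[l]; first by rewrite /= cats0 => -[sl [_ sc]]; exists l.
  by case=> sl sc; exists l; rewrite cats0; do 2!split=> //; apply/List.Forall_forall.
case: (sentences_const wphi) => -[N h]; [left|right]; exists N => n /h hn.
  have /card_gt0P [a _] := fdom_nonempty (A n).
  by apply/(E n (fun _ => a)); apply: hn.
by move=> sc; apply: hn => e; apply/E.
Qed.

Lemma ev_ldef_exists_far r s (B : forall S : structure L, dom S -> Prop) V m :
  (forall i, V i -> i < m) ->
  (forall x, loc_def Sg (pred1 x) (pred1 x) r (fun S e => B S (e x))) ->
  ev_ldef V (fun S e => exists a, ~ near Sg s V e a /\ B S a).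
Proof.
(* With this spacing an [s]-ball contains at most one point of a scattered set, as [scattered_size]
   needs. *)
move=> Vm Bd; pose c := s + s.
have split_far S (e : nat -> dom S) (l : seq (dom S)) :
    scattered Sg c B l -> ~ List.Forall (near Sg s V e) l ->
    exists a, ~ near Sg s V e a /\ B S a.
  elim: l => [|a l IH] /=; first by move=> _ [].
  case=> Ba [_ /IH h] nl.
  case: (classic (near Sg s V e a)) => na; last by exists a.
  by apply: h => h; apply: nl; constructor.
pose T k := exists N, forall n, N <= n -> some_scattered c B k (struct n).
have [[N hN]|nT] := classic (T m.+1).
  exists (fun _ _ => True), N; split; first by exists 0; apply: loc_def_true.
  move=> n /hN [l [sl sc]] e; split=> // _; apply: (split_far _ _ _ sc) => nl.
  by have := scattered_size Vm nl sc; rewrite sl ltnn.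
(* The empty list gives [T 0], and [T m.+1] fails, so some [k] satisfies [T k] but not [T k.+1]. By
   eventual constancy, the failure of [T k.+1] means that eventually no such set exists. *)
have [k [[N hN] [M hM]]] : exists k, T k /\
    exists M, forall n, M <= n -> ~ some_scattered c B k.+1 (struct n).
  elim: (m.+1) nT => [[]|j IH nT]; first by exists 0 => n _; exists [::].
  case: (classic (T j)) => [Tj | /IH //]; exists j; split=> //.
  by case: (some_scattered_const c j.+1 Bd).
pose tau : query L := fun S e => exists l, size l = k /\ List.Forall (near Sg s V e) l /\
  scattered Sg c B (l ++ map e [::]).
have tau_ldef : ldef Sg V tau.
  apply: (@definable_scattered L Sg (ldef Sg) V _ c B _ _ _ _ k V m [::]) => //.
  - exact: ldef_iff.
  - by move=> U vs Uvs; exists (maxn r c); apply: loc_def_scattered.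
  - by move=> U j Q; apply: ldef_exists_near.
  - move=> S e i a b Vi; apply: near_ext => j Vj.
    by apply: assign_other; apply: contraNneq Vi => <-.
(* The radius [s + c] reaches every point within [c] of a point of the [s]-ball. *)
pose shell : query L := fun S e =>
  exists a, near Sg (s + c) V e a /\ (~ near Sg s V e a /\ B S a).
have shell_ldef : ldef Sg V shell.
  have h : ldef Sg (predU1 m V) (fun S e => ~ near Sg s V e (e m) /\ B S (e m)).
    apply: ldef_and.
      apply: ldef_not; exists s; apply: loc_def_mono (loc_def_near Sg s m Vm) => //= i.
      by move=> ->; rewrite orbT.
    by exists r; apply: loc_def_mono (Bd m) => //= i ->.
  apply: ldef_iff (ldef_exists_near (s + c) Vm (fun _ h => h) h) => S e.
  have E a : near Sg s V (assign e m a) a <-> near Sg s V e a.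
    by apply: near_ext => j /Vm jm; rewrite assign_other // ltn_eqF.
  by split=> -[a [na h']]; exists a; split=> //; move: h'; rewrite assign_same E.
exists (fun S e => ~ tau S e \/ shell S e), (maxn N M); split.
  by apply: ldef_or shell_ldef; apply: ldef_not.
move=> n; rewrite geq_max => /andP[/hN [l [sl sc]] /hM no] e; split; last first.
  case=> [nt | [a [_ h]]]; last by exists a.
  by apply: (split_far _ _ _ sc) => nl; apply: nt; exists l; rewrite cats0.
(* If [tau] holds with the list [l'], then [a] is within [c] of some point of [l']; otherwise
   [a :: l'] would be scattered of size [k.+1]. *)
case=> a [na Ba]; case: (classic (tau _ e)) => [[l' [sl' [nl' sc']]]|nt]; [right | by left].
rewrite cats0 in sc'.
exists a; split=> //; apply: NNPP => nsh; apply: no; exists (a :: l').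
rewrite /= sl'; split=> //; split=> //; split=> //.
apply/List.Forall_forall => b bl ab; apply: nsh.
move/List.Forall_forall: nl' => /(_ b bl) [i [Vi ib]].
exists i; split=> //; apply: within_trans ib _.
exact: within_sym.
Qed.

Lemma ev_ldef_exists V i m Q : (forall j, V j -> j < m) -> ~~ V i ->
  ev_ldef (predU1 i V) Q ->
  ev_ldef V (fun S e => exists a, Q S (assign e i a)).
Proof.
move=> Vm Vi [Q' [N [[r dQ'] hQ']]].
have iV (S : structure L) (e : nat -> dom S) a j : V j -> assign e i a j = e j.
  by move=> Vj; apply: assign_other; apply: contraNneq Vi => <-.
have [f [wf hf]] := dQ'.
(* Marking [V] puts the parameters in the first component and [i] alone in the second. *)
have [l [wl hl]] := feferman_vaught V wf.
(* Two [r]-balls that meet have centres within [r + r], and a link between them costs one more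
   step. *)
pose s := (r + r).+1.
pose far l' : query L := fun S e => exists a, ~ near Sg s V e a /\
  sat_pairs (near Sg r V e) (within Sg r a) (assign e i a) l'.
have far_ldef : ev_ldef V (far l).
  elim: l wl {hl} => [_|p l IH /= /andP[/andP[w1 w2] /IH {}IH]].
    exists (fun _ _ => ~ True), 0; split; last by move=> n _ e; split=> [[a []]|[]].
    by exists 0; apply: loc_def_not; apply: loc_def_true.
  (* Only [i] can be free in [p.2], so a constant assignment evaluates it, and renaming all
     variables to [x] makes [B] definable at any [x]. *)
  pose B S (a : dom S) := sat (within Sg r a) (fun _ => a) p.2.
  have Bd x : loc_def Sg (pred1 x) (pred1 x) r (fun S e => B S (e x)).
    have h := @loc_def_relativize L Sg p.2 r _ (pred1 x) (pred1 x) (fun _ => x) x.+1 w2.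
    apply: loc_def_iff (h _ _ _) => [S e|||] //=; last by move=> j /eqP ->.
    apply: (sat_ext w2) => // a; split; first by case=> j [/eqP ->].
    by exists x; rewrite /= eqxx.
  have alpha : ev_ldef V (fun S e => sat (near Sg r V e) e p.1).
    apply: ev_ldef_of; exists r.
    have h := @loc_def_relativize L Sg p.1 r _ V V (fun j => j) m w1.
    by apply: loc_def_iff (h _ _ _) => // j /andP[].
  have h := ev_ldef_or (ev_ldef_and alpha (ev_ldef_exists_far s Vm Bd)) IH.
  apply: ev_ldef_iff h; exists 0 => n _ e.
  have F1 a : sat (near Sg r V e) (assign e i a) p.1 <-> sat (near Sg r V e) e p.1.
    by apply: (sat_ext w1) => // j /andP[_ Vj]; apply: iV.
  have F2 a : sat (within Sg r a) (assign e i a) p.2 <-> B _ a.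
    apply: (sat_ext w2) => // j /=; case: (eqVneq j i) => [-> _|_ /=].
      exact: assign_same.
    by case: (V j).
  split.
    case=> a [na /= [[/(F1 a) s1 /(F2 a) s2]|sp]]; [left | by right; exists a].
    by split=> //; exists a.
  case=> [[s1 [a [na Ba]]]|[a [na sp]]]; exists a; split=> //; [left|by right].
  by split; [apply/F1|apply/F2].
have close_ldef : ldef Sg V (fun S e => exists a, near Sg s V e a /\ Q' S (assign e i a)).
  by exists (s + r); apply: loc_def_exists_near Vm _ Vi dQ'.
apply: ev_ldef_iff (ev_ldef_or (ev_ldef_of close_ldef) far_ldef).
exists N => n /hQ' h e.
have far_sat a : ~ near Sg s V e a -> Q' _ (assign e i a) <->
    sat_pairs (near Sg r V e) (within Sg r a) (assign e i a) l.
  (* By locality [Q'] can be evaluated inside the union of the two balls, where the splitting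
     applies. *)
  move=> na; rewrite -(hf _ (fun b => near Sg r V e b \/ within Sg r a b)).
    apply: hl.
      move=> x y [j [Vj jx]] ay; split=> [xy|xy]; apply: na; exists j; split=> //.
        left; apply: within_trans jx _; rewrite xy; exact: within_sym.
      rewrite /s -addSn; apply: within_trans (within_sym ay).
      by right; exists x.
    move=> j /=; case: (eqVneq j i) => [->|ji] /=.
      by rewrite (negbTE Vi) assign_same => _; apply: within0.
    move=> Vj; rewrite Vj assign_other //; exists j; split=> //; exact: within0.
  move=> b [j [/= /orP[/eqP ->|Vj]]]; first by rewrite assign_same; right.
  by rewrite (iV _ e) // => jb; left; exists j.
split.
  case=> a /h Qa; case: (classic (near Sg s V e a)) => na; [left|right]; exists a => //.
  by split=> //; apply/far_sat.
case=> -[a [na Qa]]; exists a; apply/h => //.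
by apply/far_sat.
Qed.

Lemma ev_ldef_sat phi V m : (forall j, V j -> j < m) -> wff Sg V phi ->
  ev_ldef V (fun S e => sat (whole (S := S)) e phi).
Proof.
elim: phi V m.
- move=> i j V m Vm wf; apply: ev_ldef_of; exists 0, (FEq i j); split=> //.
- move=> r t V m Vm wf; apply: ev_ldef_of; exists 0, (FRel t); split=> //.
- by move=> f IH V m Vm wf; apply: ev_ldef_not; apply: IH Vm wf.
- move=> f IHf g IHg V m Vm /= /andP[wf wg].
  by apply: ev_ldef_and; [apply: IHf Vm wf | apply: IHg Vm wg].
- move=> i f IH V m Vm /= wf.
  (* [i] may already belong to [V]. Its outer value is shadowed, so it is removed first, as
     [ev_ldef_exists] requires. *)
  apply: (@ev_ldef_mono (predD1 V i)) => [j /= /andP[] //|].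
  have Vm' j : predD1 V i j -> j < m by case/andP => _ /Vm.
  have : ev_ldef (predU1 i (predD1 V i)) (fun S e => sat (whole (S := S)) e f).
    apply: (IH _ (maxn m i.+1)).
      by move=> j /= /orP[/eqP ->|/andP[_ /Vm]]; lia.
    by apply: wff_mono wf => j /=; case: (eqVneq j i).
  move=> /(ev_ldef_exists Vm') [|Q' [N [d h]]]; first by rewrite /= eqxx.
  exists Q', N; split=> // n /h k e; rewrite -k /=.
  by split=> -[a sa]; exists a; [case: sa|].
Qed.

End EventualLocality.

(** * Stone pairings and convergence *)

Lemma pbP (P : Prop) : reflect P (pb P).
Proof. by rewrite /pb; case: excluded_middle_informative => h; constructor. Qed.

Lemma free_in_mono (L : signature) (V U : pred nat) (phi : formula L) :
  (forall i, V i -> U i) -> free_in V phi -> free_in U phi.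
Proof.
move=> VU /(free_in_wff (Sg := syms phi) (fun _ h => h)) /(wff_mono VU).
exact: wff_free_in.
Qed.

Lemma Nat_powE m n : Nat.pow m n = expn m n.
Proof. by elim: n => //= n ->; rewrite expnS. Qed.

(** The solution set of a sentence is everything or empty, so the value is the same for every [p];
    this is how convergence passes from [FO_p] to sentences. *)
Lemma stone_sentence (L : signature) (p : nat) (phi : formula L) (A : finStructure L) e :
  FO_p 0 phi ->
  stone p phi A = if pb (sat (whole (S := struct_of A)) e phi) then 1%R else 0%R.
Proof.
move=> phi0; rewrite /stone Nat_powE.
have E (v : {ffun 'I_p -> fdom A}) :
    pb (holds (S := struct_of A) (env_of v) phi) = pb (sat (whole (S := struct_of A)) e phi).
  by apply/pbP/pbP => /(holds_in_sat (e := e) _ phi0) h; apply: h.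
have card0 : INR (expn #|fdom A| p) <> 0%R.
  by apply: not_0_INR => /eqP; rewrite expn_eq0 -leqn0 leqNgt fdom_nonempty.
have [t|nt] := boolP (pb (sat _ e phi)).
  have -> : [set v : {ffun 'I_p -> fdom A} |
      pb (holds (S := struct_of A) (env_of v) phi)] = setT.
    by apply/setP => v; rewrite !inE E.
  by rewrite cardsT card_ffun card_ord; field.
have -> : [set v : {ffun 'I_p -> fdom A} |
    pb (holds (S := struct_of A) (env_of v) phi)] = set0.
  by apply/setP => v; rewrite !inE E (negbTE nt).
by rewrite cards0 /Rdiv Rmult_0_l.
Qed.

Lemma fin_assignment (L : signature) (A : finStructure L) :
  exists e : nat -> dom (struct_of A), True.
Proof. by have /card_gt0P[a _] := fdom_nonempty A; exists (fun _ => a). Qed.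

Lemma eq_convergent (u v : nat -> R) N :
  (forall n, N <= n -> u n = v n) -> convergent u -> convergent v.
Proof.
move=> uv [l ul]; exists l => eps /ul [M hM]; exists (maxn N M) => n /leP.
by rewrite geq_max => /andP[/uv <- /leP]; apply: hM.
Qed.

Lemma convergent_sentence (L : signature) (A : nat -> finStructure L) (phi : formula L) :
  FO_p 0 phi -> convergent (fun n => stone 0 phi (A n)) ->
  eventually_const (fun n => forall e, sat (whole (S := struct_of (A n))) e phi).
Proof.
(* The values 0 and 1 cannot both lie at distance less than 1/2 from the limit. *)
move=> phi0 [l hl]; have [|N hN] := hl (1 / 2)%R; first lra.
have same n : N <= n -> stone 0 phi (A n) = stone 0 phi (A N).
  move=> /leP /hN; have := hN N (le_n N); rewrite /Rdist.
  have [e _] := fin_assignment (A n); have [e' _] := fin_assignment (A N).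
  rewrite (stone_sentence 0 e phi0) (stone_sentence 0 e' phi0).
  by case: ifP; case: ifP => // _ _; split_Rabs; lra.
have [e' _] := fin_assignment (A N).
case: (pbP (sat (whole (S := struct_of (A N))) e' phi)) => h; [left|right];
  exists N => n /same.
  move=> + e; rewrite (stone_sentence 0 e phi0) (stone_sentence 0 e' phi0).
  by case: pbP => // _; case: pbP => // _; lra.
move=> + sn; have [e _] := fin_assignment (A n).
rewrite (stone_sentence 0 e phi0) (stone_sentence 0 e' phi0).
by case: pbP => // _; case: pbP => // _; lra.
Qed.

(** Links in [Sg] are Gaifman adjacencies, except that a point may be linked to itself; such a step
    is dropped. The Gaifman ball may be larger, since symbols outside [Sg] contribute to it. *)
Lemma within_gaif (L : signature) (Sg : seq (sym L)) (S : structure L) d (x y : dom S) :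
  within Sg d x y -> gaif_within d x y.
Proof.
elim: d y => //= d IH y [/IH|[z [/IH xz [r [t [_ [rt ab]]]]]]]; first by left.
case: (classic (z = y)) => [<-|zy]; first by left.
by right; exists z; split=> //; split=> //; exists r, t.
Qed.

Lemma FOp_convergent_of_local (L : signature) (A : nat -> finStructure L) p :
  FOlocal_p_convergent p A -> FOp_convergent 0 A -> FOp_convergent p A.
Proof.
(* For [p = 0] the claim is the hypothesis on sentences. For positive [p], some coordinate of [v] is
   available as a default for the variables out of range; [inord] in [ext] picks the first one. *)
case: p => // p locA senA phi phip.
pose Sg := syms phi; pose V : pred nat := fun k => k < p.+1.
have wphi : wff Sg V phi by apply: free_in_wff.
have const f (wf : wff Sg pred0 f) :
    eventually_const (fun n => forall e, sat (whole (S := struct_of (A n))) e f).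
  have f0 : FO_p 0 f by apply: free_in_mono (wff_free_in wf).
  exact: convergent_sentence f0 (senA _ f0).
have [Q [N [[r [psi [wpsi hpsi]]] hN]]] := ev_ldef_sat const (m := p.+1) (fun _ h => h) wphi.
have psip : FO_p p.+1 psi := wff_free_in wpsi.
pose ext (S : structure L) (v : 'I_p.+1 -> dom S) : nat -> dom S := fun k => v (inord k).
have extE (S : structure L) (v : 'I_p.+1 -> dom S) k : V k -> env_of v k = Some (ext S v k).
  by move=> kp; rewrite /env_of insubT /ext; congr (Some (v _)); apply: val_inj; rewrite /= inordK.
(* The Gaifman ball contains the ball measured through [Sg], so [psi] expresses [Q] both there and
   in the whole structure. *)
have locpsi : FO_local_p p.+1 psi.
  split=> //; exists r => S v.
  rewrite /holds (holds_in_sat _ psip (extE S v)) (holds_in_sat _ psip (extE S v)).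
  rewrite !hpsi // => a [i [Vi /within_gaif ia]].
  by exists (inord i).
apply: (@eq_convergent (fun n => stone p.+1 psi (A n)) _ N) (locA _ locpsi) => n /hN hn.
rewrite /stone; congr (INR _ / _)%R; apply: eq_card => v; rewrite !inE.
pose w : 'I_p.+1 -> dom (struct_of (A n)) := v.
have e1 := holds_in_sat (whole (S := struct_of (A n))) phip (extE _ w).
have e2 := holds_in_sat (whole (S := struct_of (A n))) psip (extE _ w).
have e3 := hpsi _ (whole (S := struct_of (A n))) (ext _ w) (fun _ _ => I).
by apply/pbP/pbP => h; [apply/e1/hn/e3/e2 | apply/e2/e3/hn/e1].
Qed.

Lemma FOp_convergent_sentences (L : signature) (A : nat -> finStructure L) p :
  FOp_convergent p A -> FOp_convergent 0 A.
Proof.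
move=> cA phi phi0; have phip : FO_p p phi by apply: free_in_mono phi0.
apply: (@eq_convergent (fun n => stone p phi (A n)) _ 0) (cA _ phip) => n _.
by have [e _] := fin_assignment (A n); rewrite !(stone_sentence _ e phi0).
Qed.

Theorem theorem5p3 (L : signature) (A : nat -> finStructure L) :
  (FO_convergent A <-> FOlocal_convergent A /\ FOp_convergent 0 A) /\
  (forall p : nat,
     FOp_convergent p A <-> FOlocal_p_convergent p A /\ FOp_convergent 0 A).
Proof.
have H p : FOp_convergent p A <-> FOlocal_p_convergent p A /\ FOp_convergent 0 A.
  split=> [cA|[locA senA]]; last exact: FOp_convergent_of_local.
  by split; [move=> phi [/cA] | apply: FOp_convergent_sentences cA].
split=> //; split=> [cA|[locA senA] p]; last by apply/H.
by split=> [p|]; [case/H: (cA p) | apply: cA].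
Qed.
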